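(* Let $G=(V,E)$ be a finite, simple, connected, undirected graph and $K\ge1$ an integer. Then $c(G)=K$ if and only if $\widetilde{c}(G)=K$. In particular $c(G)=\widetilde{c}(G)$.
   Context: For a node $u$, $N[u]$ denotes the closed neighborhood of $u$. $c(G)$ is the classical cop number: the minimum number of cops sufficient to capture the robber in the classical turn-based cops and robber game on $G$ (the cops first choose initial positions, then the robber does; thereafter the players alternate, the cops moving first, each token moving to a node in the closed neighborhood of its current node; capture occurs when a cop and the robber occupy the same node), when both players play optimally. The concurrent cops and robber game (CCCR) on $G$ with $K$ cops: the game starts from a given initial position (cop locations $x_0\in V^K$ and robber location $y_0\in V$). In each round $t=1,2,\dots$ both players move simultaneously: each cop moves from $x_{t-1}^i$ to some node of $N[x^i_{t-1}]$ and the robber moves from $y_{t-1}$ to some node of $N[y_{t-1}]$. Both players know all current and past positions. Capture occurs at the first round $t$ in which either some cop and the robber occupy the same node after the move, or some cop moves from $x^i_{t-1}$ to $y_{t-1}$ while the robber simultaneously moves from $y_{t-1}$ to $x^i_{t-1}$ (''en passant'' capture); after capture the positions remain fixed. Players may use randomized strategies, i.e. at each round the next move is chosen according to a probability distribution on $V$ that may depend on the entire history of positions. The concurrent cop number $\widetilde{c}(G)$ is the minimum number $K$ of cops such that, for every initial position, the cops have a strategy that ensures capture with probability one against every robber strategy, in the CCCR game on $G$. *)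

(* Defs.v *)
From HB Require Import structures.
From mathcomp Require Import all_boot all_order all_algebra.
From mathcomp Require Import all_classical all_reals all_analysis.

Set Implicit Arguments.
Unset Strict Implicit.
Unset Printing Implicit Defensive.

Import Order.TTheory GRing.Theory Num.Theory.

Local Open Scope classical_set_scope.
Local Open Scope ring_scope.

Record simple_connected_graph (V : finType) (e : rel V) : Prop := {
  graph_nonempty : (0 < #|V|)%N;
  graph_sym : symmetric e;
  graph_irrefl : irreflexive e;
  graph_connected : forall u v : V, connect e u v
}.

Definition closed_nbh (V : finType) (e : rel V) (u : V) : {set V} :=
  [set v | (v == u) || e u v]%SET.

(* [least P] is 0 when no natural number satisfies [P].  No confusion arises
   for the two cop numbers below: on a nonempty graph zero cops never suffice,
   so a genuine minimum is always positive. *)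
Definition least (P : nat -> Prop) : nat :=
  xget 0%N [set K | P K /\ forall K', P K' -> (K <= K')%N].

(* The cop locations and the robber location.  Histories are sequences of
   positions, oldest first; they are written [s0 :: h] to be nonempty, the
   current position then being [last s0 h]. *)
Definition position (V : finType) (K : nat) : Type := ({ffun 'I_K -> V} * V)%type.

(* [past X t] is the history X 0, ..., X t. *)
Definition past (S : Type) (X : nat -> S) (t : nat) : seq S := mkseq X t.+1.

Definition cr_cop_strategy (V : finType) (K : nat) : Type :=
  seq (position V K) -> {ffun 'I_K -> V}.

Definition cr_legal (V : finType) (e : rel V) (K : nat)
    (sigma : cr_cop_strategy V K) : Prop :=
  forall s0 h i, sigma (s0 :: h) i \in closed_nbh e ((last s0 h).1 i).

(* [X t] is the position once both players have completed [t] turns ([X 0] being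
   the initial placement); the robber picks [(X t.+1).2] after seeing the cop
   move [(X t.+1).1], so any legal choice is allowed. *)
Definition cr_play (V : finType) (e : rel V) (K : nat)
    (sigma : cr_cop_strategy V K) (X : nat -> position V K) : Prop :=
  forall t, (X t.+1).1 = sigma (past X t) /\
            (X t.+1).2 \in closed_nbh e (X t).2.

(* The first disjunct is capture at the initial placement or by the robber's
   move, the second one capture by a cop move. *)
Definition cr_captured (V : finType) (K : nat)
    (X : nat -> position V K) : Prop :=
  exists t i, (X t).1 i = (X t).2 \/ (X t.+1).1 i = (X t).2.

Definition cr_cops_win (V : finType) (e : rel V) (K : nat) : Prop :=
  exists (x0 : {ffun 'I_K -> V}) (sigma : cr_cop_strategy V K),
    cr_legal e sigma /\
    forall (y0 : V) (X : nat -> position V K),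
      X 0%N = (x0, y0) -> cr_play e sigma X -> cr_captured X.

Definition cop_number (V : finType) (e : rel V) : nat :=
  least (cr_cops_win e).

(* Same node after the move, or en passant. *)
Definition capture_move (V : finType) (K : nat) (s s' : position V K) : bool :=
  [exists i, (s'.1 i == s'.2) || ((s'.1 i == s.2) && (s'.2 == s.1 i))].

Fixpoint captured_along (V : finType) (K : nat) (s0 : position V K)
    (h : seq (position V K)) : bool :=
  if h is s :: h' then capture_move s0 s || captured_along s h' else false.

(* Randomized strategy of a single token: the law of its next node, given the
   history. *)
Definition token_strategy (R : realType) (V : finType) (K : nat) : Type :=
  seq (position V K) -> V -> R.

Definition token_legal (R : realType) (V : finType) (e : rel V) (K : nat)
    (loc : position V K -> V) (sigma : token_strategy R V K) : Prop :=
  forall s0 h,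
    [/\ forall v, 0 <= sigma (s0 :: h) v,
        \sum_v sigma (s0 :: h) v = 1 &
        forall v, sigma (s0 :: h) v != 0 -> v \in closed_nbh e (loc (last s0 h))].

(* Probability that [s] follows the history [s0 :: h]: all tokens draw their
   next node independently given the history; positions are frozen after
   capture. *)
Definition transition (R : realType) (V : finType) (K : nat)
    (sigma : 'I_K -> token_strategy R V K) (tau : token_strategy R V K)
    (s0 : position V K) (h : seq (position V K)) (s : position V K) : R :=
  if captured_along s0 h then (s == last s0 h)%:R
  else (\prod_i sigma i (s0 :: h) (s.1 i)) * tau (s0 :: h) s.2.

(* [X] is a random play from [s0] under the strategies [sigma] and [tau]: given
   that the first rounds were [s0 :: h], the next position has law
   [transition sigma tau s0 h]. *)
Definition random_play (R : realType) (V : finType) (K : nat)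
    (sigma : 'I_K -> token_strategy R V K) (tau : token_strategy R V K)
    (s0 : position V K) (d : measure_display) (T : measurableType d)
    (P : probability T R) (X : T -> nat -> position V K) : Prop :=
  [/\ forall t s, measurable [set w | X w t = s],
      P [set w | X w 0%N = s0] = 1%E &
      forall h s,
        P [set w | past (X w) (size h).+1 = s0 :: rcons h s] =
        (P [set w | past (X w) (size h) = s0 :: h] *
         (transition sigma tau s0 h s)%:E)%E].

(* Every random play is captured with probability one.  By the Ionescu-Tulcea
   theorem random plays exist, and they all have the same law. *)
Definition captured_almost_surely (R : realType) (V : finType) (K : nat)
    (sigma : 'I_K -> token_strategy R V K) (tau : token_strategy R V K)
    (s0 : position V K) : Prop :=
  forall (d : measure_display) (T : measurableType d) (P : probability T R)
    (X : T -> nat -> position V K),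
    random_play sigma tau s0 P X ->
    P [set w | exists t, capture_move (X w t) (X w t.+1)] = 1%E.

Definition cccr_cops_win (R : realType) (V : finType) (e : rel V) (K : nat) :
    Prop :=
  forall s0 : position V K,
  exists sigma : 'I_K -> token_strategy R V K,
    (forall i, token_legal e (fun s => s.1 i) (sigma i)) /\
    forall tau : token_strategy R V K,
      token_legal e (fun s => s.2) tau -> captured_almost_surely sigma tau s0.

Definition concurrent_cop_number (R : realType) (V : finType) (e : rel V) : nat :=
  least (cccr_cops_win R e).

(* Main.v *)
(* Call a position [s] forced if, for some [n], the cops can arrange a capture
   within [n] rounds of the concurrent game when they are shown the robber's
   next move before choosing their own.  Both games are won by [K] cops exactly
   when every position is forced.
   - From an unforced position the robber has a move which, whatever the cops do
     simultaneously, avoids capture and leads to an unforced position.  In the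
     concurrent game he plays it against any randomized strategy and is never
     captured; in the classical game it is his answer to the previous cop move.
     The cops can walk to any placement without leaving the unforced positions,
     so no initial placement wins the classical game.
   - If all positions are forced, they are so within a common number [N] of
     rounds.  In the concurrent game cops moving uniformly at random make the
     right moves with probability at least [p ^ N], [p = |V| ^ -K], so they fail
     for [k * N] rounds with probability at most [(1 - p ^ N) ^ k]. *)
Require Import Defs.
From mathcomp Require Import all_boot all_order all_algebra.
From mathcomp Require Import all_classical all_reals all_analysis.

Set Implicit Arguments.
Unset Strict Implicit.
Unset Printing Implicit Defensive.

Import Order.TTheory GRing.Theory Num.Theory.

(** * Histories of a play *)

Lemma past_last (S : Type) (X : nat -> S) (x0 : S) t : last x0 (past X t) = X t.
Proof. by rewrite /past /mkseq -addn1 iotaD map_cat last_cat. Qed.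

Lemma pastS (S : Type) (X : nat -> S) t : past X t.+1 = rcons (past X t) (X t.+1).
Proof. by rewrite /past /mkseq -[t.+2]addn1 iotaD map_cat cats1. Qed.

Lemma past_cons (S : Type) (X : nat -> S) t :
  past X t = X 0 :: [seq X i | i <- iota 1 t].
Proof. by []. Qed.

(** * Forced positions and the classical game *)

Definition cops_step (V : finType) (e : rel V) (K : nat) (x x' : {ffun 'I_K -> V}) : bool :=
  [forall i, x' i \in closed_nbh e (x i)].

(** Capture is a property of moves, so zero rounds force nothing, even if a cop shares the robber's
    node; that cop needs one round, following the robber's announced move. *)
Fixpoint forces (V : finType) (e : rel V) (K n : nat) (s : position V K) : bool :=
  if n is n'.+1 then
    [forall y' in closed_nbh e s.2, [exists x' : {ffun 'I_K -> V},
      cops_step e s.1 x' && (capture_move s (x', y') || forces e n' (x', y'))]]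
  else false.

Definition forced (V : finType) (e : rel V) (K : nat) (s : position V K) : Prop :=
  exists n, forces e n s.

Section Forcing.
Variables (V : finType) (e : rel V) (K : nat).
Implicit Types (x : {ffun 'I_K -> V}) (y v : V) (s : position V K) (h : seq (position V K)).

Lemma closed_nbh_refl v : v \in closed_nbh e v.
Proof. by rewrite inE eqxx. Qed.

Lemma cops_step_refl x : cops_step e x x.
Proof. by apply/forallP => i; exact: closed_nbh_refl. Qed.

Lemma forces_leq m n s : m <= n -> forces e m s -> forces e n s.
Proof.
elim: m n s => [|m IH] [|n] s //= mn /forall_inP H.
apply/forall_inP => y' /H /existsP[x' /andP[lx' /orP c]].
apply/existsP; exists x'; rewrite lx' /=; apply/orP.
by case: c => [->|/(IH n _ mn) ->]; [left|right].
Qed.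

Lemma forces_uniform : (forall s, forced e s) -> exists n, forall s, forces e n s.
Proof.
move=> /fin_all_exists[f Hf]; exists (\max_s f s) => s.
by apply: forces_leq (Hf s); exact: leq_bigmax.
Qed.

(** If every robber move had a reply that captures or leads to a forced position, then, moves being
    finitely many, the largest round count plus one would force [s]. *)
Lemma unforced_escape s : ~ forced e s ->
  exists2 y', y' \in closed_nbh e s.2 & forall x', cops_step e s.1 x' ->
    ~~ capture_move s (x', y') /\ ~ forced e (x', y').
Proof.
move=> nf; apply: contrapT => noesc; apply: nf.
suff /fin_all_exists[f Hf] : forall y', exists n, y' \in closed_nbh e s.2 ->
   exists x', cops_step e s.1 x' && (capture_move s (x', y') || forces e n (x', y')).
  exists (\max_y f y).+1; apply/forall_inP => y' /Hf[x' /andP[lx' /orP c]].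
  apply/existsP; exists x'; rewrite lx' /=; apply/orP.
  case: c => [->|c]; [by left|right].
  by apply: forces_leq c; exact: (@leq_bigmax _ f).
move=> y'; apply: contrapT => nn; apply: noesc; exists y'.
  by apply: contrapT => ny; apply: nn; exists 0 => /ny.
move=> x' lx'; split.
  apply/negP => c; apply: nn; exists 0 => _; exists x'.
  by rewrite lx' c.
by case=> n Hn; apply: nn; exists n => _; exists x'; rewrite lx' Hn orbT.
Qed.

Lemma unforced_escape_fun : exists rho : position V K -> V,
  forall s, rho s \in closed_nbh e s.2 /\ (~ forced e s ->
    forall x', cops_step e s.1 x' ->
    ~~ capture_move s (x', rho s) /\ ~ forced e (x', rho s)).
Proof.
suff /fin_all_exists[rho Hrho] : forall s, exists y', y' \in closed_nbh e s.2 /\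
    (~ forced e s -> forall x', cops_step e s.1 x' ->
      ~~ capture_move s (x', y') /\ ~ forced e (x', y')) by exists rho.
move=> s; have [fs|/unforced_escape[y' ly' H]] := pselect (forced e s).
  by exists s.2; split=> //; exact: closed_nbh_refl.
by exists y'.
Qed.

(** All cops walk at once, each along a path to his target; the early ones wait there for the
    others. *)
Lemma cops_reachable (P : {ffun 'I_K -> V} -> Prop) x x' :
  (forall u v, connect e u v) ->
  (forall z z', cops_step e z z' -> P z -> P z') -> P x -> P x'.
Proof.
move=> con Pstep Px.
have /fin_all_exists[p Hp] : forall i, exists p,
    path e (x i) p /\ x' i = last (x i) p.
  by move=> i; have /connectP[p] := con (x i) (x' i); exists p.
(* The default value of [nth] makes cop [i] wait at [x' i] once his path is exhausted. *)
pose z t := [ffun i => nth (x' i) (x i :: p i) t].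
have z0 : z 0 = x by apply/ffunP => i; rewrite ffunE.
have step t : cops_step e (z t) (z t.+1).
  apply/forallP => i; rewrite !ffunE inE.
  have [pe le] := Hp i.
  have [tp|tp] := ltnP t (size (p i)).
    by apply/orP; right; exact: (pathP _ pe).
  rewrite [nth _ _ t.+1]nth_default //= {1}le.
  case: (ltngtP t (size (p i))) tp => // [tp _|-> _].
    by rewrite nth_default // {1}le eqxx.
  by rewrite -last_nth eqxx.
have zT : z (\max_i (size (p i))).+1 = x'.
  apply/ffunP => i; rewrite ffunE nth_default //=.
  exact: (@leq_bigmax _ (fun i => size (p i))).
rewrite -zT; elim: _.+1 => [|t]; first by rewrite z0.
exact: Pstep.
Qed.

(** With [s'.2] read as the classical robber's actual node, this is the disjunction in
    [cr_captured]: an en passant capture means that he has stepped onto a cop. *)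
Lemma capture_moveP s s' : capture_move s s' ->
  exists i, s.1 i = s'.2 \/ s'.1 i = s'.2.
Proof.
by case/existsP => i /orP[/eqP|/andP[_ /eqP]] H; exists i; [right|left].
Qed.

End Forcing.

(* The cops play the concurrent game against a robber lagging one move behind:
   they pretend that his last move is still to be made, simultaneously with
   theirs, and thus know it in advance. *)
Lemma forced_cr_cops_win (V : finType) (e : rel V) (K : nat) :
  0 < #|V| -> (forall s : position V K, forced e s) -> cr_cops_win e K.
Proof.
move=> /card_gt0P[v0 _] all_forced.
(* The least forcing time is the rank that the cops decrease in every round. *)
pose rk s := ex_minn (all_forced s).
have rk_forces s : forces e (rk s) s by rewrite /rk; case: ex_minnP.
have rk_le s n : forces e n s -> rk s <= n.
  by rewrite /rk; case: ex_minnP => m _; exact.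
have /fin_all_exists[mv Hmv] : forall sy : position V K * V, exists x',
    cops_step e sy.1.1 x' /\ (sy.2 \in closed_nbh e sy.1.2 ->
      capture_move sy.1 (x', sy.2) || (rk (x', sy.2) < rk sy.1)).
  (* Against an illegal robber move the cops stay put, which keeps [mv] total and legal. *)
  move=> [s y'] /=; have [ly'|ny'] := boolP (y' \in closed_nbh e s.2); last first.
    by exists s.1; split=> //; exact: cops_step_refl.
  move: (rk_forces s); case: (rk s) => [//|n] /= /forall_inP /(_ _ ly').
  move=> /existsP[x' /andP[lx' c]]; exists x'; split=> // _.
  by case/orP: c => [->|/rk_le c]; rewrite // ltnS c orbT.
pose prev (s0 : position V K) h := (last s0 (belast s0 h)).2.
pose sigma (h : seq (position V K)) :=
  if h is s0 :: h' then mv (((last s0 h').1, prev s0 h'), (last s0 h').2)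
  else [ffun=> v0].
exists [ffun=> v0], sigma; split.
  move=> s0 h i.
  by have [/forallP/(_ i)] := Hmv (((last s0 h).1, prev s0 h), (last s0 h).2).
move=> y0 X X0 playX; apply: contrapT => ncapt.
(* The lagging position. At time 0 the predecessor is 0 again: the robber's pretended first move is
   to stay where he was placed. *)
pose u t := ((X t).1, (X t.-1).2) : position V K.
have sigmaE t : sigma (past X t) = mv (u t, (X t).2).
  have := past_last X (X 0) t; rewrite past_cons /= => ->.
  rewrite /u; congr (mv (_, _, _)); case: t => [//|t].
  have {}/(congr1 behead) := pastS X t; rewrite [behead (rcons _ _)]/= => E.
  rewrite -[map _ _]/(behead (past X t.+1)) E /prev belast_rcons.
  by rewrite -past_cons past_last.
have dec t : rk (u t.+1) < rk (u t).
  have [Xt1 _] := playX t.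
  have lX : (X t).2 \in closed_nbh e (X t.-1).2.
    by case: t {Xt1} => [|t]; [exact: closed_nbh_refl|have [] := playX t].
  have [_ /(_ lX)] := Hmv (u t, (X t).2); rewrite -sigmaE -Xt1.
  case/orP => // /capture_moveP[i /= c]; exfalso; apply: ncapt.
  by exists t, i.
have bound t : rk (u t) + t <= rk (u 0).
  elim: t => [|t IH]; first by rewrite addn0.
  by rewrite addnS (leq_trans _ IH) // -addSn leq_add2r dec.
by have := leq_trans (leq_addl _ _) (bound (rk (u 0)).+1); rewrite ltnn.
Qed.

Lemma cr_cops_win_forced (V : finType) (e : rel V) (K : nat) :
  (forall u v, connect e u v) -> cr_cops_win e K ->
  forall s : position V K, forced e s.
Proof.
move=> con [x0 [sigma [sigma_legal win]]] s; apply: contrapT => nfs.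
have [rho Hrho] := unforced_escape_fun e K.
(* While the cops walk from [s.1] to [x0], the robber answers with [rho] and the position stays
   unforced. *)
have [y nfy] : exists y, ~ forced e (x0, y).
  apply: (@cops_reachable V e K (fun x => exists y, ~ forced e (x, y)) s.1) => //.
    move=> z z' lz [y nfy]; have [_ /(_ nfy _ lz)[_ nf]] := Hrho (z, y).
    by exists (rho (z, y)).
  by exists s.2; rewrite -surjective_pairing.
pose s0 : position V K := (x0, rho (x0, y)).
pose next h : position V K :=
  let x' := sigma h in (x', rho (x', (last s0 h).2)).
pose hist := fix hist t :=
  if t is t'.+1 then rcons (hist t') (next (hist t')) else [:: s0].
pose X t := last s0 (hist t).
have histE t : past X t = hist t.
  elim: t => [//|t IH]; rewrite pastS IH /X /=.
  by rewrite last_rcons.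
have XS t : X t.+1 = next (hist t) by rewrite /X /= last_rcons.
have hist_cons t : exists h, hist t = s0 :: h.
  by elim: t => [|t [h /= ->]]; [exists [::]|exists (rcons h (next (s0 :: h)))].
have Xstep t : cops_step e (X t).1 (X t.+1).1.
  apply/forallP => i; rewrite XS /= /X; have [h ->] := hist_cons t.
  exact: sigma_legal.
(* The cops' current nodes with the robber's previous one, [y] serving as his node before the
   placement. His actual node is the escape [rho] from [u t], and [u t] stays unforced. *)
pose u t : position V K := ((X t).1, if t is t'.+1 then (X t').2 else y).
have XrhoE t : (X t).2 = rho (u t).
  by case: t => [//|t]; rewrite XS /u XS.
have nfu t : ~ forced e (u t).
  elim: t => [//|t IH]; have [_ /(_ IH _ (Xstep t))[_]] := Hrho (u t).
  by rewrite -XrhoE.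
have playX : cr_play e sigma X.
  move=> t; rewrite histE; split; first by rewrite XS.
  by rewrite XrhoE; have [] := Hrho (u t.+1).
have [t [i c]] := win _ X (erefl _) playX.
(* The escape works against every legal cop step: standing still excludes a shared node at time [t],
   the actual next step excludes capture by a cop move. *)
have [_ /(_ (nfu t)) esc] := Hrho (u t).
case: c => c.
  have [/existsP + _] := esc _ (cops_step_refl e (X t).1); apply; exists i => /=.
  by rewrite -XrhoE c eqxx.
have [/existsP + _] := esc _ (Xstep t); apply; exists i => /=.
by rewrite -XrhoE c eqxx.
Qed.

Import numFieldNormedType.Exports.
Local Open Scope classical_set_scope.
Local Open Scope ring_scope.

(** * Existence of random plays *)

Section NestedIntervals.
Variables (R : realType) (S : finType) (s0 : S) (kappa : seq S -> S -> R).
Hypothesis kappa_ge0 : forall h s, 0 <= kappa h s.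
Hypothesis kappa_sum : forall h, \sum_s kappa h s = 1.

Definition cumul (h : seq S) (k : nat) : R :=
  \sum_(0 <= j < k) kappa h (nth s0 (enum S) j).

Lemma cumulS h k : cumul h k.+1 = cumul h k + kappa h (nth s0 (enum S) k).
Proof. by rewrite /cumul big_nat_recr. Qed.

Lemma cumul_le h j k : (j <= k)%N -> cumul h j <= cumul h k.
Proof.
move=> jk; rewrite /cumul (big_cat_nat _ jk) //= lerDl.
by apply: sumr_ge0 => *; exact: kappa_ge0.
Qed.

Lemma cumul_card h : cumul h #|S| = 1.
Proof.
by rewrite /cumul cardE -(big_nth s0 predT) big_enum kappa_sum.
Qed.

Lemma cumul_index h s :
  cumul h (index s (enum S)).+1 = cumul h (index s (enum S)) + kappa h s.
Proof. by rewrite cumulS nth_index // mem_enum. Qed.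

(* Left endpoint and length of the interval of a history, newest position
   first: the interval of a history is cut into one piece per next position,
   with lengths proportional to the transition probabilities. *)
Fixpoint cell_bounds (r : seq S) : R * R :=
  if r is s :: r' then
    let: (a, l) := cell_bounds r' in
    (a + l * cumul (rev r') (index s (enum S)), l * kappa (rev r') s)
  else (0, 1).

Definition cell (r : seq S) : interval R :=
  `[(cell_bounds r).1, (cell_bounds r).1 + (cell_bounds r).2[.

Lemma cell_len_ge0 r : 0 <= (cell_bounds r).2.
Proof.
elim: r => [|s r] //=; case: (cell_bounds r) => a l /= l0.
exact: mulr_ge0.
Qed.

Lemma cell_sub s r w : w \in cell (s :: r) -> w \in cell r.
Proof.
have := cell_len_ge0 r; rewrite /cell !in_itv /=.
case: (cell_bounds r) => a l /= l0 /andP[wl wr]; apply/andP; split.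
  apply: le_trans wl; rewrite lerDl mulr_ge0 //.
  by rewrite -(_ : cumul (rev r) 0 = 0) ?cumul_le // /cumul big_nil.
apply: (lt_le_trans wr); rewrite -addrA lerD2l -mulrDr -cumul_index.
rewrite -[leRHS]mulr1 ler_wpM2l // -(cumul_card (rev r)) cumul_le //.
by rewrite cardE index_mem mem_enum.
Qed.

Lemma cell_bounds01 r :
  0 <= (cell_bounds r).1 /\ (cell_bounds r).1 + (cell_bounds r).2 <= 1.
Proof.
elim: r => [|s r] /=; first by rewrite add0r.
have := cell_len_ge0 r; case: (cell_bounds r) => a l /= l0 [a0 al1]; split.
  rewrite addr_ge0 // mulr_ge0 //.
  by rewrite -(_ : cumul (rev r) 0 = 0) ?cumul_le // /cumul big_nil.
apply: le_trans al1; rewrite -addrA lerD2l -mulrDr -cumul_index.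
rewrite -[leRHS]mulr1 ler_wpM2l // -(cumul_card (rev r)) cumul_le //.
by rewrite cardE index_mem mem_enum.
Qed.

(** The piece containing [w] is the one before the least [k] whose left endpoint exceeds [w];
    minimality puts [w] to the right of its own left endpoint. *)
Lemma cell_split r w : w \in cell r -> exists s, w \in cell (s :: r).
Proof.
have := cell_len_ge0 r; rewrite /cell in_itv /=.
case E : (cell_bounds r) => [a l] /= l0 /andP[wl wr].
have ex : exists k, w < a + l * cumul (rev r) k.
  by exists #|S|; rewrite cumul_card mulr1.
case: (ex_minnP ex) => -[|k] wk kmin.
  by move: wk; rewrite /cumul big_nil mulr0 addr0 ltNge wl.
have kS : (k < size (enum S))%N.
  by rewrite -cardE; apply: kmin; rewrite cumul_card mulr1.
exists (nth s0 (enum S) k); rewrite in_itv /= index_uniq ?enum_uniq //.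
rewrite -addrA -mulrDr -cumulS wk andbT leNgt; apply/negP => /kmin.
by rewrite ltnn.
Qed.

(** Pieces are laid out in the order of [enum S], so an earlier piece ends no later than the other
    begins, and the intervals are half-open. *)
Lemma cell_inj s s' r w : w \in cell (s :: r) -> w \in cell (s' :: r) -> s = s'.
Proof.
wlog le_ss : s s' / (index s (enum S) <= index s' (enum S))%N.
  move=> H; have [le|/ltnW le] := leqP (index s (enum S)) (index s' (enum S)).
    exact: H.
  by move=> ? ?; apply/esym; exact: H.
have := cell_len_ge0 r; rewrite /cell !in_itv /=.
case: (cell_bounds r) => a l /= l0 /andP[_ wr] /andP[wl _].
move: le_ss; rewrite leq_eqVlt => /orP[/eqP E|lt].
  by rewrite -(nth_index s0 (mem_enum _ s)) E nth_index ?mem_enum.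
suff : w < w by rewrite ltxx.
apply: (lt_le_trans wr); apply: le_trans wl.
by rewrite -addrA lerD2l -mulrDr -cumul_index ler_wpM2l // cumul_le.
Qed.

Fixpoint itinerary (w : R) (n : nat) : seq S :=
  if n is n'.+1 then
    let r := itinerary w n' in
    odflt s0 [pick s | w \in cell (s :: r)] :: r
  else [::].

(** Cells of one generation partition the root cell: [cell_split] gives a next position and
    [cell_inj] its uniqueness. So the default in [itinerary] is never taken for such [w]. *)
Lemma itineraryP w r : w \in cell [::] ->
  (itinerary w (size r) == r) = (w \in cell r).
Proof.
move=> w01; elim: r => [|s r IH] /=; first by rewrite w01.
rewrite eqseq_cons IH; have [wr|wr] := boolP (w \in cell r); last first.
  by rewrite andbF; apply/esym/negP => /cell_sub; exact/negP.
rewrite andbT; have /eqP -> : itinerary w (size r) == r by rewrite IH.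
case: pickP => [s' ws'|nw] /=.
  apply/eqP/idP => [<- //|ws]; exact: cell_inj ws' ws.
by have [s' ws'] := cell_split wr; move: (nw s'); rewrite /= ws'.
Qed.

Lemma size_itinerary w n : size (itinerary w n) = n.
Proof. by elim: n => //= n ->. Qed.

Definition unit_interval_prob : probability (measurableTypeR R) R :=
  uniform_prob (@ltr01 R).

Lemma unit_interval_prob_itv (a b : R) : 0 <= a -> a <= b -> b <= 1 ->
  unit_interval_prob `[a, b[%classic = (b - a)%:E.
Proof.
move=> a0 ab b1; rewrite /unit_interval_prob /= /uniform_prob.
rewrite (eq_integral (cst 1%E)); last first.
  move=> x; rewrite inE /= in_itv /= => /andP[ax xb].
  by rewrite /uniform_pdf (le_trans a0 ax) (ltW (lt_le_trans xb b1)) subr0 invr1.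
rewrite integral_cst //= mul1e lebesgue_measure_itv /= lte_fin.
case: ltP => // ba; have -> : b = a by apply/eqP; rewrite eq_le ab ba.
by rewrite subrr.
Qed.

(** The sample space is the whole line; points outside the root cell, a null set, are sent to 0 so
    that every sample has an itinerary. *)
Definition clamp (w : R) : R := if (0 <= w) && (w < 1) then w else 0.

Lemma clamp_in01 w : clamp w \in cell [::].
Proof.
rewrite /clamp /cell in_itv /= add0r.
by case: ifP => // _; rewrite lexx ltr01.
Qed.

Lemma measurable_clamp (I : interval R) :
  measurable [set w : measurableTypeR R | clamp w \in I].
Proof.
rewrite (_ : [set _ | _] = (`[0, 1[%classic `&` [set` I]) `|`
    (~` `[0, 1[%classic `&` [set w | 0 \in I])).
  apply: measurableU; apply: measurableI.
  - exact: measurable_itv.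
  - exact: measurable_itv.
  - by apply: measurableC; exact: measurable_itv.
  - have [h|h] := boolP (0 \in I).
      by rewrite (_ : [set _ | _] = setT) //; apply/seteqP; split.
    by rewrite (_ : [set _ | _] = set0) //; apply/seteqP; split.
apply/seteqP; split => w /=; rewrite /clamp !in_itv /=; case: ifP => // w01.
- by left.
- by right.
- by case=> -[].
- by case=> -[].
Qed.

Lemma prob_clamp_cell r :
  unit_interval_prob [set w | clamp w \in cell r] = (cell_bounds r).2%:E.
Proof.
have m01 : measurable (`[0, 1[%classic : set (measurableTypeR R)).
  exact: measurable_itv.
have null : unit_interval_prob (~` `[0, 1[%classic) = 0%E.
  by rewrite probability_setC // unit_interval_prob_itv // subr0 subee.
have mr := measurable_clamp (cell r).
set A := [set w | _] in mr *; set D : set (measurableTypeR R) := `[0, 1[%classic in m01 null.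
transitivity (unit_interval_prob (A `&` D) + unit_interval_prob (A `&` ~` D))%E.
  rewrite -measureU.
  - by rewrite -setIUr setUv setIT.
  - exact: measurableI.
  - by apply: measurableI => //; exact: measurableC.
  - by apply/seteqP; split => // w [[_ ?] []].
have [a0 b1] := cell_bounds01 r.
have -> : unit_interval_prob (A `&` D) =
    ((cell_bounds r).1 + (cell_bounds r).2 - (cell_bounds r).1)%:E.
  rewrite -(unit_interval_prob_itv a0 _ b1) ?lerDl ?cell_len_ge0 //.
  congr (unit_interval_prob _).
  apply/seteqP; split => w; rewrite /A /D /= /clamp !in_itv /=.
    by move=> [+ w01]; rewrite w01.
  move=> wr; have w01 : (0 <= w) && (w < 1).
    by case/andP: wr => wl wr; rewrite (le_trans a0 wl) (lt_le_trans wr b1).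
  by rewrite w01.
rewrite (_ : unit_interval_prob (A `&` ~` D) = 0%E).
  by rewrite adde0 addrAC subrr add0r.
apply/eqP; rewrite eq_le measure_ge0 andbT -null le_measure ?inE //.
- by apply: measurableI => //; exact: measurableC.
- exact: measurableC.
Qed.

(** Refuting almost sure capture requires an actual random play. A uniform point of the unit
    interval encodes one through the nested cells containing it. Transitions have nonzero
    probability at every sample, not just almost surely, because a half-open interval of length 0 is
    empty. *)
Lemma exists_process : exists X : measurableTypeR R -> nat -> S,
  [/\ forall t s, measurable [set w | X w t = s],
      forall w, X w 0%N = s0,
      forall w t h, past (X w) t = s0 :: h -> kappa h (X w t.+1) != 0 &
      forall h s,
        unit_interval_prob [set w | past (X w) (size h).+1 = s0 :: rcons h s] =
        (unit_interval_prob [set w | past (X w) (size h) = s0 :: h] *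
         (kappa h s)%:E)%E].
Proof.
(* Itineraries omit the initial position, so at time 0 the list is empty and the default [s0] is the
   value. *)
pose X (w : measurableTypeR R) t := head s0 (itinerary (clamp w) t).
have pastX w t : past (X w) t = s0 :: rev (itinerary (clamp w) t).
  by elim: t => [//|t IH]; rewrite pastS IH [in RHS]/= rev_cons.
have eventE h : [set w | past (X w) (size h) = s0 :: h] =
    [set w | clamp w \in cell (rev h)].
  apply/seteqP; split => w /=; rewrite pastX.
    by case=> E; rewrite -itineraryP ?clamp_in01 // size_rev -[h in rev h]E revK.
  by rewrite -itineraryP ?clamp_in01 // size_rev => /eqP ->; rewrite revK.
exists X; split=> // [t s|w t h|h s].
  rewrite (_ : [set w | X w t = s] =
     \bigcup_(r in [set r : t.-tuple S | head s0 r = s])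
       [set w | clamp w \in cell r]).
    apply: fin_bigcup_measurable; first exact: finite_finset.
    by move=> r _; exact: measurable_clamp.
  apply/seteqP; split => w /=.
    move=> Xs; have st : size (itinerary (clamp w) t) == t by rewrite size_itinerary.
    exists (Tuple st) => //=.
    by rewrite -itineraryP ?clamp_in01 // size_itinerary.
  case=> r hr /=; rewrite -itineraryP ?clamp_in01 // size_tuple /X.
  by move=> /eqP ->.
- rewrite pastX => -[<-]; apply/eqP => k0.
  have : clamp w \in cell (itinerary (clamp w) t.+1).
    by rewrite -itineraryP ?clamp_in01 // size_itinerary.
  move: k0; rewrite /X /cell in_itv /=; case: cell_bounds => a l /= ->.
  by rewrite mulr0 addr0 => /andP[/le_lt_trans /[apply]]; rewrite ltxx.
rewrite -(size_rcons h s) !eventE !prob_clamp_cell rev_rcons /= revK.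
by case: (cell_bounds (rev h)) => a l /=; rewrite EFinM.
Qed.

End NestedIntervals.

(** * Capture probabilities in the concurrent game *)

Lemma captured_along_rcons (V : finType) (K : nat) (s0 : position V K) h s :
  captured_along s0 (rcons h s) = captured_along s0 h || capture_move (last s0 h) s.
Proof. by elim: h s0 => [|s1 h IH] s0 /=; rewrite ?orbF // IH orbA. Qed.

Lemma captured_along_past (V : finType) (K : nat) (s0 : position V K)
    (X : nat -> position V K) t h :
  past X t = s0 :: h ->
  captured_along s0 h -> exists2 t', (t' < t)%N & capture_move (X t') (X t'.+1).
Proof.
move=> E; have <- : behead (past X t) = h by rewrite E.
have <- : X 0%N = s0 by case: E.
elim: t {h E} => [//|t IH].
have -> : behead (past X t.+1) = rcons (behead (past X t)) (X t.+1) by rewrite pastS.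
rewrite captured_along_rcons => /orP[/IH[t' lt c]|c].
  by exists t' => //; exact: leqW.
by exists t => //; rewrite -(past_last X (X 0%N) t).
Qed.

Lemma measure_le_sum (R : realType) (I : finType) (d : measure_display)
    (T : measurableType d) (mu : {measure set T -> \bar R}) (A : set T) (B : I -> set T) :
  measurable A -> (forall i, measurable (B i)) ->
  (forall w, A w -> exists i, B i w) -> (mu A <= \sum_i mu (B i))%E.
Proof.
move=> mA mB AB; pose U s := \big[setU/set0]_(i <- s) B i.
have mU s : measurable (U s) by apply: bigsetU_measurable.
apply: (@le_trans _ _ (mu (U (index_enum I)))).
  rewrite le_measure ?inE // => w /AB[i Bi].
  by rewrite /U -bigcup_seq; exists i => //=; rewrite mem_index_enum.
rewrite /U; elim: (index_enum I) => [|i s IH].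
  by rewrite !big_nil measure0.
rewrite !big_cons; apply: le_trans (leeD2l _ IH).
by apply: measureU2 => //; exact: (mU s).
Qed.

Section Transition.
Variables (R : realType) (V : finType) (e : rel V) (K : nat).
Variables (sigma : 'I_K -> token_strategy R V K) (tau : token_strategy R V K).
Hypothesis sigma_legal : forall i, token_legal e (fun s => s.1 i) (sigma i).
Hypothesis tau_legal : token_legal e (fun s => s.2) tau.
Variable s0 : position V K.
Implicit Types (h : seq (position V K)) (s : position V K).

Lemma sigma_ge0 h x : 0 <= \prod_i sigma i (s0 :: h) (x i).
Proof. by apply: prodr_ge0 => i _; have [] := sigma_legal i s0 h. Qed.

Lemma sigma_sum h : \sum_(x : {ffun 'I_K -> V}) \prod_i sigma i (s0 :: h) (x i) = 1.
Proof.
rewrite -(bigA_distr_bigA (fun i => sigma i (s0 :: h))).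
by apply: big1 => i _; have [] := sigma_legal i s0 h.
Qed.

Lemma tau_ge0 h y : 0 <= tau (s0 :: h) y.
Proof. by have [] := tau_legal s0 h. Qed.

Lemma tau_sum h : \sum_y tau (s0 :: h) y = 1.
Proof. by have [] := tau_legal s0 h. Qed.

Lemma transition_ge0 h s : 0 <= transition sigma tau s0 h s.
Proof.
rewrite /transition; case: ifP => _; first exact: ler0n.
by rewrite mulr_ge0 ?sigma_ge0 ?tau_ge0.
Qed.

(** The cops' draw is independent of the robber's, so it may be averaged for each fixed robber move,
    as if that move were known. *)
Lemma sum_transition h (f : position V K -> R) : ~~ captured_along s0 h ->
  \sum_s transition sigma tau s0 h s * f s =
  \sum_y tau (s0 :: h) y *
    \sum_(x : {ffun 'I_K -> V}) (\prod_i sigma i (s0 :: h) (x i)) * f (x, y).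
Proof.
move=> nc; under eq_bigr do rewrite /transition (negbTE nc).
under [RHS]eq_bigr do rewrite big_distrr.
rewrite exchange_big pair_bigA /=; apply: eq_bigr => -[x y] _ /=.
by rewrite mulrCA mulrA.
Qed.

Lemma transition_sum h : \sum_s transition sigma tau s0 h s = 1.
Proof.
have [c|nc] := boolP (captured_along s0 h).
  rewrite (bigD1 (last s0 h)) //= /transition c eqxx big1 ?addr0 //.
  by move=> s /negbTE ->.
under eq_bigr do rewrite -[transition _ _ _ _ _]mulr1.
rewrite (sum_transition (fun=> 1) nc).
by under eq_bigr do (under eq_bigr do rewrite mulr1; rewrite sigma_sum mulr1);
  exact: tau_sum.
Qed.

(* The probability, given the history [s0 :: h], of no capture in [n] more
   rounds. *)
Fixpoint evade (n : nat) h : R :=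
  if captured_along s0 h then 0 else
  if n is n'.+1 then
    \sum_s transition sigma tau s0 h s * evade n' (rcons h s)
  else 1.

Lemma evade_captured n h : captured_along s0 h -> evade n h = 0.
Proof. by case: n => /= [|n] ->. Qed.

Lemma evade_ge0 n h : 0 <= evade n h.
Proof.
elim: n h => [|n IH] h /=; case: ifP => // _.
by apply: sumr_ge0 => s _; rewrite mulr_ge0 ?transition_ge0.
Qed.

Lemma evadeS n h : ~~ captured_along s0 h ->
  evade n.+1 h = \sum_s transition sigma tau s0 h s * evade n (rcons h s).
Proof. by move=> /= /negbTE ->. Qed.

(** Each additional initial round replaces the evasion probability by an average of values at most
    [c], or by 0. *)
Lemma evade_le c m n : 0 <= c -> (forall h, evade n h <= c) ->
  forall h, evade (m + n)%N h <= c.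
Proof.
move=> c0 Hn; elim: m => [//|m IH] h; rewrite addSn.
have [cap|nc] := boolP (captured_along s0 h); first by rewrite evade_captured.
rewrite evadeS // -[leRHS]mul1r -(transition_sum h) mulr_suml.
by apply: ler_sum => s _; rewrite ler_wpM2l ?transition_ge0.
Qed.

Variable p : R.
Hypothesis p01 : 0 <= p <= 1.
Hypothesis sigma_ge : forall h x, cops_step e (last s0 h).1 x ->
  p <= \prod_i sigma i (s0 :: h) (x i).

(** For each robber move, the forcing reply is drawn with probability at least [p] and leaves at
    most [c * (1 - p ^+ m)]; any other draw leaves at most [c]. The average is at most
    [c * (1 - p * p ^+ m)]. *)
Lemma evade_forces c m n h : 0 <= c -> (forall h, evade n h <= c) ->
  forces e m (last s0 h) -> evade (m + n)%N h <= c * (1 - p ^+ m).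
Proof.
move=> c0 Hn; elim: m h => [//|m IH] h; rewrite addSn.
have /andP[p0 p1] := p01.
have pm k : 0 <= c * (1 - p ^+ k) by rewrite mulr_ge0 // subr_ge0 exprn_ile1.
have [cap _|nc] := boolP (captured_along s0 h); first by rewrite evade_captured.
rewrite evadeS // sum_transition // => /forall_inP /= forcing.
have -> : c * (1 - p ^+ m.+1) = \sum_y tau (s0 :: h) y * (c * (1 - p ^+ m.+1)).
  by rewrite -mulr_suml tau_sum mul1r.
apply: ler_sum => y _.
have [->|ty] := eqVneq (tau (s0 :: h) y) 0; first by rewrite !mul0r.
rewrite ler_wpM2l ?tau_ge0 //.
have /forcing /existsP[x /andP[lx Hx]] : y \in closed_nbh e (last s0 h).2.
  by have [_ _] := tau_legal s0 h; exact.
have evx : evade (m + n)%N (rcons h (x, y)) <= c * (1 - p ^+ m).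
  case/orP: Hx => [cap|fm]; last by apply: IH; rewrite last_rcons.
  by rewrite evade_captured ?pm // captured_along_rcons cap orbT.
(* The indicator of [z == x] merges the two bounds, for the forcing reply and for the other draws,
   into one summand. *)
apply: (@le_trans _ _ (\sum_(z : {ffun 'I_K -> V})
    (\prod_i sigma i (s0 :: h) (z i)) * (c - (z == x)%:R * (c * p ^+ m)))).
  apply: ler_sum => z _; rewrite ler_wpM2l ?sigma_ge0 //.
  have [->|_] := eqVneq z x; last by rewrite mul0r subr0 evade_le.
  by rewrite mul1r (le_trans evx) // mulrBr mulr1.
under eq_bigr do rewrite mulrBr.
rewrite sumrB -mulr_suml sigma_sum mul1r mulrBr mulr1 lerD2l lerN2.
rewrite (bigD1 x) //= [X in _ <= _ + X]big1 ?addr0; last by move=> z /negbTE zx; rewrite zx mul0r mulr0.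
rewrite eqxx mul1r exprS mulrCA ler_wpM2r ?sigma_ge //.
by rewrite mulr_ge0 // exprn_ge0.
Qed.

Lemma evade_geometric N : (forall s, forces e N s) ->
  forall k h, evade (k * N)%N h <= (1 - p ^+ N) ^+ k.
Proof.
move=> forcing; have /andP[p0 p1] := p01; elim=> [|k IH] h.
  by rewrite mul0n /=; case: ifP.
rewrite mulSn exprSr evade_forces // exprn_ge0 // subr_ge0.
exact: exprn_ile1.
Qed.

(** * From evasion probabilities to almost sure capture *)

Section RandomPlay.
Context (d : measure_display) (T : measurableType d) (P : probability T R).
Variable X : T -> nat -> position V K.
Hypothesis rX : random_play sigma tau s0 P X.

Let measurableX t s : measurable [set w | X w t = s].
Proof. by have [] := rX. Qed.

Lemma measurable_capture t :
  measurable [set w | capture_move (X w t) (X w t.+1)].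
Proof.
rewrite (_ : [set _ | _] = \bigcup_(ss in [set ss | capture_move ss.1 ss.2])
   ([set w | X w t = ss.1] `&` [set w | X w t.+1 = ss.2])).
  apply: fin_bigcup_measurable; first exact: finite_finset.
  by move=> ss _; exact: measurableI.
apply/seteqP; split => w /=; first by exists (X w t, X w t.+1).
by case=> -[s s'] /= c [-> ->].
Qed.

Lemma measurable_past n l : measurable [set w | past (X w) n = l].
Proof.
elim: n l => [|n IH] l.
  case: l => [|s [|s' l]].
  - by rewrite (_ : [set _ | _] = set0) //; apply/seteqP; split.
  - rewrite (_ : [set _ | _] = [set w | X w 0%N = s]) //.
    by apply/seteqP; split => w /=; [case|move=> <-].
  - by rewrite (_ : [set _ | _] = set0) //; apply/seteqP; split.
case/lastP: l => [|l s].
  by rewrite (_ : [set _ | _] = set0) //; apply/seteqP; split.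
rewrite (_ : [set _ | _] = [set w | past (X w) n = l] `&` [set w | X w n.+1 = s]).
  exact: measurableI.
by apply/seteqP; split => w /=; rewrite pastS; [move=> /rcons_inj[]|case=> -> ->].
Qed.

Lemma measurable_uncaught n :
  measurable [set w | forall t, (t < n)%N -> ~~ capture_move (X w t) (X w t.+1)].
Proof.
elim: n => [|n IH].
  by rewrite (_ : [set _ | _] = setT) //; apply/seteqP; split.
rewrite (_ : [set _ | _] =
   [set w | forall t, (t < n)%N -> ~~ capture_move (X w t) (X w t.+1)] `&`
   ~` [set w | capture_move (X w n) (X w n.+1)]).
  by apply: measurableI => //; apply: measurableC; exact: measurable_capture.
apply/seteqP; split => w /=.
  by move=> H; split=> [t tn|]; [apply: H; exact: leqW|apply/negP; exact: H].
move=> [H1 H2] t; rewrite ltnS leq_eqVlt => /orP[/eqP ->|]; last exact: H1.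
exact/negP.
Qed.

(** Induction on [n], splitting over the next position, carries the recursion of [evade] over to any
    random play. The horizon [size h + n] includes the rounds already in [h]. *)
Lemma prob_uncaught n h :
  (P ([set w | past (X w) (size h) = s0 :: h] `&`
      [set w | forall t, (t < size h + n)%N -> ~~ capture_move (X w t) (X w t.+1)])
   <= P [set w | past (X w) (size h) = s0 :: h] * (evade n h)%:E)%E.
Proof.
elim: n h => [|n IH] h; have [cap|nc] := boolP (captured_along s0 h).
- rewrite evade_captured // mule0 (_ : _ `&` _ = set0) ?measure0 //.
  apply/seteqP; split => // w /= [E H].
  have [t lt c] := captured_along_past E cap.
  by have := H t; rewrite addn0 c => /(_ lt).
- rewrite /= (negbTE nc) mule1 le_measure ?inE //; first apply: measurableI.
  + exact: measurable_past.
  + exact: measurable_uncaught.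
  + exact: measurable_past.
- rewrite evade_captured // mule0 (_ : _ `&` _ = set0) ?measure0 //.
  apply/seteqP; split => // w /= [E H].
  have [t lt c] := captured_along_past E cap.
  by have := H t; rewrite c => /(_ (leq_trans lt (leq_addr _ _))).
pose A s := [set w | past (X w) (size h).+1 = s0 :: rcons h s] `&`
  [set w | forall t, (t < (size h).+1 + n)%N -> ~~ capture_move (X w t) (X w t.+1)].
have mA s : measurable (A s).
  by apply: measurableI; [exact: measurable_past|exact: measurable_uncaught].
apply: (@le_trans _ _ (\sum_(s : position V K) P (A s))%E).
  apply: measure_le_sum => //.
    by apply: measurableI; [exact: measurable_past|exact: measurable_uncaught].
  move=> w [/= E H]; exists (X w (size h).+1); split=> /=.
    by rewrite pastS E.
  by move=> t; rewrite addSnnS; exact: H.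
have [_ _ step] := rX.
rewrite evadeS // -sumEFin ge0_sume_distrr => [|s _]; last first.
  by rewrite lee_fin mulr_ge0 ?transition_ge0 ?evade_ge0.
apply: lee_sum => s _; rewrite EFinM muleA -step -(size_rcons h s).
by rewrite /A -(size_rcons h s); exact: IH.
Qed.

Lemma capture_almost_sure (r : R) : 0 <= r < 1 ->
  (forall k, exists n, evade n [::] <= r ^+ k) ->
  P [set w | exists t, capture_move (X w t) (X w t.+1)] = 1%E.
Proof.
move=> /andP[r0 r1] decay; set C := [set w | _].
have mC : measurable C.
  rewrite (_ : C = \bigcup_t [set w | capture_move (X w t) (X w t.+1)]).
    by apply: bigcupT_measurable => t; exact: measurable_capture.
  by apply/seteqP; split => w /= [t]; [exists t|move=> _; exists t].
have [_ X0 _] := rX.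
(* A random play starts at [s0] only almost surely; the samples starting elsewhere are null and
   enter by a union bound. *)
pose Z := [set w | X w 0%N = s0].
have ZC0 : P (~` Z) = 0%E.
  by rewrite probability_setC; [rewrite X0 subee|exact: measurableX].
suff CC0 : P (~` C) = 0%E.
  by rewrite -(setCK C) probability_setC; [rewrite CC0 sube0|exact: measurableC].
have bound k : (P (~` C) <= (r ^+ k)%:E)%E.
  have [n evn] := decay k.
  pose B := [set w | past (X w) 0 = s0 :: [::]] `&`
    [set w | forall t, (t < 0 + n)%N -> ~~ capture_move (X w t) (X w t.+1)].
  have mB : measurable B.
    by apply: measurableI; [exact: measurable_past|exact: measurable_uncaught].
  have mZ : measurable (~` Z) by apply: measurableC; exact: measurableX.
  apply: (@le_trans _ _ (P (~` Z `|` B))).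
    rewrite le_measure ?inE //; [exact: measurableC|exact: measurableU|].
    move=> w nC; have [Zw|nZw] := pselect (Z w); [right|by left].
    split=> [|t _] /=; first by rewrite -Zw.
    by apply/negP => c; apply: nC; exists t.
  apply: (le_trans (measureU2 _ mZ mB)); rewrite [X in (X + _)%E]ZC0 add0e.
  apply: (le_trans (prob_uncaught n [::])).
  rewrite (_ : [set w | _] = Z); last first.
    by apply/seteqP; split => w /=; [case|move=> Xw; rewrite -Xw].
  by rewrite X0 mul1e lee_fin.
have PCfin : P (~` C) \is a fin_num by rewrite fin_num_measure //; exact: measurableC.
apply/eqP; rewrite eq_le measure_ge0 andbT -(fineK PCfin) lee_fin.
have := @cvg_expr R r; rewrite ger0_norm // => /(_ r1) cvgr.
apply: (cvgr_to_ge cvgr); apply: nearW => k.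
by rewrite -lee_fin fineK.
Qed.
End RandomPlay.
End Transition.

(** * The concurrent game and forced positions *)

Definition uniform_cop (R : realType) (V : finType) (e : rel V) (K : nat)
    (i : 'I_K) : token_strategy R V K :=
  fun h v => if h is s :: h' then
    let N := closed_nbh e ((last s h').1 i) in (v \in N)%:R / #|N|%:R
  else 0.

Lemma uniform_cop_legal (R : realType) (V : finType) (e : rel V) (K : nat) (i : 'I_K) :
  token_legal e (fun s => s.1 i) (uniform_cop R e i).
Proof.
move=> s h; split=> [v||v] /=; set N := closed_nbh _ _.
- by rewrite divr_ge0 ?ler0n.
- rewrite -mulr_suml (eq_bigr _ (fun v _ => mulrb 1 (v \in N))).
  rewrite -big_mkcond sumr_const divff // pnatr_eq0 -lt0n.
  by apply/card_gt0P; exists ((last s h).1 i); exact: closed_nbh_refl.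
- by case: (v \in N); rewrite // mul0r eqxx.
Qed.

(** A closed neighborhood has at most [#|V|] nodes, so each cop makes a given legal move with
    probability at least [#|V|%:R^-1]. *)
Lemma uniform_cop_ge (R : realType) (V : finType) (e : rel V) (K : nat)
    (s0 : position V K) h (x : {ffun 'I_K -> V}) :
  cops_step e (last s0 h).1 x ->
  (#|V|%:R ^-1) ^+ K <= \prod_i uniform_cop R e i (s0 :: h) (x i).
Proof.
move=> /forallP lx.
have -> : (#|V|%:R ^-1 : R) ^+ K = \prod_(i < K) #|V|%:R^-1.
  by rewrite prodr_const card_ord.
apply: ler_prod => i _; rewrite invr_ge0 ler0n /= lx mul1r.
have N0 : (0 < #|closed_nbh e ((last s0 h).1 i)|)%N.
  by apply/card_gt0P; exists (x i); exact: lx.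
by rewrite lef_pV2 ?posrE ?ltr0n ?ler_nat ?max_card // (leq_trans N0) ?max_card.
Qed.

Lemma forced_cccr_cops_win (R : realType) (V : finType) (e : rel V) (K : nat) :
  (forall s : position V K, forced e s) -> cccr_cops_win R e K.
Proof.
move=> /forces_uniform[N forcesN] s0; exists (@uniform_cop R V e K).
split=> [i|tau tau_legal d T P X rX]; first exact: uniform_cop_legal.
have sl i := uniform_cop_legal R e (i : 'I_K).
have V0 : (0 < #|V|)%N by apply/card_gt0P; exists s0.2.
pose p : R := #|V|%:R^-1 ^+ K.
have p0 : 0 < p by rewrite exprn_gt0 // invr_gt0 ltr0n.
have p1 : p <= 1.
  by rewrite exprn_ile1 ?invr_ge0 ?ler0n // invf_le1 ?ltr0n // ler1n.
have p01 : 0 <= p <= 1 by rewrite ltW.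
apply: (capture_almost_sure sl tau_legal rX (r := 1 - p ^+ N)).
  by rewrite subr_ge0 exprn_ile1 ?(ltW p0) //= ltrBlDr ltrDl exprn_gt0.
move=> k; exists (k * N)%N.
apply: (evade_geometric sl tau_legal p01) => // h x; exact: uniform_cop_ge.
Qed.

(* Being deterministic, the robber's escape succeeds against every realization of
   the cops' moves, so it is irrelevant that he does not see them. *)
Lemma cccr_cops_win_forced (R : realType) (V : finType) (e : rel V) (K : nat) :
  cccr_cops_win R e K -> forall s : position V K, forced e s.
Proof.
move=> win s0; apply: contrapT => nf0.
have [sigma [sigma_legal captured]] := win s0.
have [rho Hrho] := unforced_escape_fun e K.
pose tau : token_strategy R V K := fun h v =>
  if h is s :: h' then (v == rho (last s h'))%:R else 0.
have tau_legal : token_legal e (fun s => s.2) tau.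
  move=> s h; split=> [v||v] /=; first exact: ler0n.
    by rewrite (bigD1 (rho (last s h))) //= eqxx big1 ?addr0 // => v /negbTE ->.
  by case: (eqVneq v (rho (last s h))) => [-> _|_]; [have [] := Hrho (last s h)|rewrite eqxx].
have [X [mX X0 Xpos Xstep]] := exists_process s0
  (transition_ge0 sigma_legal tau_legal s0) (transition_sum sigma_legal tau_legal s0).
have rX : random_play sigma tau s0 (unit_interval_prob R) X.
  split=> //; rewrite (_ : [set _ | _] = setT) ?probability_setT //.
  by apply/seteqP; split=> w //= _; exact: X0.
(* This holds at every sample: each realized transition has nonzero probability, so every cop moved
   legally and the robber played [rho]. *)
have safe w t : ~ forced e (X w t) /\
    forall t', (t' < t)%N -> ~~ capture_move (X w t') (X w t'.+1).
  elim: t => [|t [nf IH]]; first by rewrite X0.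
  have [h pastE] : exists h, past (X w) t = s0 :: h.
    by exists (behead (past (X w) t)); rewrite -{1}(X0 w).
  have nc : captured_along s0 h = false.
    apply/negP => /(captured_along_past pastE)[t' lt c].
    by have := IH _ lt; rewrite c.
  have lastE : last s0 h = X w t by rewrite -(past_last (X w) s0 t) pastE.
  have := Xpos w t h pastE; rewrite /transition nc mulf_eq0 negb_or.
  case/andP => /prodf_neq0 sn0; rewrite /= lastE.
  have [Xrho _|_] := eqVneq (X w t.+1).2 (rho (X w t)); last by rewrite eqxx.
  have lX : cops_step e (X w t).1 (X w t.+1).1.
    apply/forallP => i; rewrite -lastE.
    by have [_ _] := sigma_legal i s0 h; apply; exact: sn0.
  have [_ /(_ nf _ lX)] := Hrho (X w t); rewrite -Xrho -surjective_pairing.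
  move=> [ncX nfX]; split=> // t'; rewrite ltnS leq_eqVlt => /orP[/eqP -> //|].
  exact: IH.
have := captured _ tau_legal _ _ _ _ rX.
rewrite (_ : [set _ | _] = set0); last first.
  apply/seteqP; split => // w /= [t c].
  by have [_ /(_ t (ltnSn t))] := safe w t.+1; rewrite c.
rewrite measure0 => /eqP; rewrite eq_sym onee_eq0 //.
Qed.

Theorem theorem3p7 (R : realType) (V : finType) (e : rel V)
    (Ge : simple_connected_graph e) :
  (forall K : nat, (1 <= K)%N ->
     (cop_number e = K <-> concurrent_cop_number R e = K)) /\
  cop_number e = concurrent_cop_number R e.
Proof.
suff eq_numbers : cop_number e = concurrent_cop_number R e.
  by rewrite eq_numbers.
(* For each [K], either game is won exactly when all positions are forced, so both minima are taken
   over the same set. *)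
congr least; apply/funext => K; apply/propext.
have [V0 _ _ con] := Ge; split.
  by move=> /(cr_cops_win_forced con); exact: forced_cccr_cops_win.
by move=> /cccr_cops_win_forced; exact: forced_cr_cops_win.
Qed.
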